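(* Let $A=\theta I-B\in\mathbb{R}^{n\times n}$ be a symmetric M-matrix, where $B\ge0$ (entrywise) and $\|B\|_2\le\theta$. Let $f$ be a real function that is continuous over $[\theta-\|B\|_2,\theta+\|B\|_2]$ and analytic over $(\theta-\|B\|_2,\theta+\|B\|_2+\varepsilon)$ for some $\varepsilon>0$, and let $d$ be a positive integer such that $$(-1)^kf^{(k)}(\theta)\ge0\quad\text{for all } k\ge d.$$ Then $$[f(A)]_{ij}\ge0\quad\text{for all } i,j \text{ with } \mathrm{d}(i,j)\ge d.$$
   Context: A matrix $A\in\mathbb{R}^{n\times n}$ is a (possibly singular) M-matrix if $A=\theta I-B$ with $B\ge0$ entrywise and spectral radius $\rho(B)\le\theta$; for symmetric $B$, $\rho(B)=\|B\|_2$ (spectral norm). For symmetric $A$, $f(A)$ is the matrix function defined through the spectral decomposition; $[M]_{ij}$ is the $(i,j)$ entry of $M$. $\mathrm{d}(i,j)$ is the geodesic (shortest path) distance in the undirected graph $\mathcal{G}(A)$ with vertices $\{1,\dots,n\}$ and edges $\{(i,j):i\ne j,\ [A]_{ij}\ne0\}$, with $\mathrm{d}(i,i)=0$ and $\mathrm{d}(i,j)=\infty$ if there is no path. *)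

(* Defs.v *)
From HB Require Import structures.
From mathcomp Require Import all_boot all_order all_algebra.
From mathcomp Require Import complex ring lra.
From mathcomp Require Import all_classical all_reals all_analysis.

Set Implicit Arguments.
Unset Strict Implicit.
Unset Printing Implicit Defensive.

Import Order.TTheory GRing.Theory Num.Theory.
Import numFieldNormedType.Exports.

Local Open Scope classical_set_scope.
Local Open Scope ring_scope.

Definition l2norm (R : realType) (n : nat) (x : 'cV[R]_n) : R :=
  Num.sqrt (\sum_i x i 0 ^+ 2).

(* The norm of matrices in the library is the entrywise maximum, hence this
   separate operator norm induced by the Euclidean norm.  The closed unit ball,
   rather than the unit sphere, makes the supremum meaningful for n = 0. *)
Definition spectral_norm (R : realType) (n : nat) (B : 'M[R]_n) : R :=
  sup [set l2norm (B *m x) | x in [set x : 'cV[R]_n | l2norm x <= 1]].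

(* The columns of Q are orthonormal eigenvectors, lam lists the eigenvalues. *)
Definition spectral_decomposition (R : realType) (n : nat) (A : 'M[R]_n)
    (Q : 'M[R]_n) (lam : 'rV[R]_n) : Prop :=
  Q *m Q^T = 1%:M /\ A = Q *m diag_mx lam *m Q^T.

(* For symmetric A, symmx_spectral and matfunE below show that the decomposition
   exists and that the value does not depend on its choice; the default value 0
   is only taken when A is not symmetric. *)
Definition matfun (R : realType) (n : nat) (f : R -> R) (A : 'M[R]_n) :
    'M[R]_n :=
  xget 0 [set M | exists Q lam, spectral_decomposition A Q lam /\
                    M = Q *m diag_mx (map_mx f lam) *m Q^T].

Definition edge (R : realType) (n : nat) (A : 'M[R]_n) : rel 'I_n :=
  fun i j => (i != j) && (A i j != 0).

(* A walk from i is i :: p and has size p edges; the infimum of the empty set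
   is +oo. *)
Definition gdist (R : realType) (n : nat) (A : 'M[R]_n) (i j : 'I_n) : \bar R :=
  ereal_inf [set (size p)%:R%:E | p in
    [set p : seq 'I_n | path (edge A) i p /\ last i p = j]].

Definition analytic_at (R : realType) (f : R -> R) (x : R) : Prop :=
  exists (c : R^nat) (r : R), 0 < r /\
    forall y, `|y - x| < r -> pseries c (y - x) @ \oo --> f y.

Definition analytic_on (R : realType) (D : set R) (f : R -> R) : Prop :=
  forall x, D x -> analytic_at f x.

Section SpectralTheorem.
Variable R : realType.

Lemma symmx_eigenvalue (n : nat) (A : 'M[R]_n.+1) :
  A^T = A -> exists a, eigenvalue A a.
Proof.
move=> symA.
pose A' := map_mx (real_complex R) A.
have hA' : A' \is hermsymmx.
  apply: realsym_hermsym.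
    apply/is_hermitianmxP; rewrite expr0 scale1r map_mx_id //.
    by rewrite /A' -[in LHS]symA map_trmx.
  apply/mxOverP => i j; rewrite mxE.
  by apply/complex_realP; exists (A i j).
have /orthomx_spectralP := hermitian_normalmx hA'.
have /mxOverP /(_ 0 0) := hermitian_spectral_diag_real hA'.
set P := spectralmx A'; set D := spectral_diag A' => /complex_realP [a Da] E.
have Pu : P \in unitmx := spectral_unit A'.
exists a; rewrite eigenvalue_root_char.
have : eigenvalue A' (real_complex R a).
  apply/eigenvalueP; exists (row 0 P); last first.
    apply/eqP => r0; have /row_freeP[P' P'E] : row_free P by rewrite row_free_unit.
    have : row 0 P *m P' = 0 by rewrite r0 mul0mx.
    rewrite -row_mul P'E => /rowP/(_ 0); rewrite !mxE eqxx => /eqP.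
    by rewrite oner_eq0.
  rewrite {1}E -row_mul !mulmxA mulmxV // mul1mx row_mul row_diag_mx.
  by rewrite -scalemxAl -rowE Da.
by rewrite eigenvalue_root_char -map_char_poly fmorph_root.
Qed.

Lemma dotr_gt0 (n : nat) (v : 'rV[R]_n) : v != 0 -> 0 < (v *m v^T) 0 0.
Proof.
move=> v0; rewrite mxE lt_def; apply/andP; split; last first.
  by apply: sumr_ge0 => i _; rewrite mxE -expr2 sqr_ge0.
apply: contra v0 => /eqP s0; apply/eqP/rowP => i; rewrite mxE.
have /(_ i isT) : forall i, true -> v 0 i * v^T i 0 = 0.
  apply/psumr_eq0P => // k _.
  by rewrite mxE -expr2 sqr_ge0.
by rewrite mxE -expr2 => /eqP; rewrite sqrf_eq0 => /eqP.
Qed.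

(* Householder reflection exchanging two unit vectors. *)
Lemma reflection_exists (n : nat) (v e : 'rV[R]_n) :
  v *m v^T = 1%:M -> e *m e^T = 1%:M ->
  exists H : 'M[R]_n, [/\ H^T = H, H *m H = 1%:M & v *m H = e].
Proof.
move=> vv ee; have [->|ve] := eqVneq v e.
  by exists 1%:M; rewrite trmx1 !mulmx1.
pose u := v - e; have u0 : u != 0 by rewrite subr_eq0.
have /lt0r_neq0 := dotr_gt0 u0; set s := (u *m u^T) 0 0 => s0.
have uu : u *m u^T = s%:M by rewrite [LHS]mx11_scalar.
pose H := 1%:M - (2 / s) *: (u^T *m u).
have sE : s = 2 - 2 * (v *m e^T) 0 0.
  have ev : e *m v^T = v *m e^T.
    by apply: trmx_inj; rewrite trmx_mul trmxK [LHS]mx11_scalar [RHS]mx11_scalar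
       !mxE; congr (_%:M); apply: eq_bigr => i _; rewrite !mxE mulrC.
  rewrite /s /u linearB /= mulmxBl !mulmxBr vv ee ev !mxE /= mulr1n.
  by ring.
have vu : v *m u^T = (s / 2)%:M.
  rewrite /u linearB /= mulmxBr vv [v *m e^T]mx11_scalar sE.
  by rewrite -raddfB; congr (_%:M); field.
exists H; split.
- by rewrite /H linearB linearZ /= trmx1 trmx_mul trmxK.
- rewrite /H; set M := u^T *m u.
  have MM : M *m M = s *: M.
    by rewrite /M mulmxA -[_ *m u *m u^T]mulmxA uu mul_mx_scalar -scalemxAl.
  rewrite mulmxBl mul1mx mulmxBr mulmx1 -scalemxAl -scalemxAr MM !scalerA.
  have -> : 2 / s * (2 / s) * s = 2 / s + 2 / s by field.
  by rewrite scalerDl opprB addrK subrK.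
rewrite /H mulmxBr mulmx1 -scalemxAr mulmxA vu mul_scalar_mx scalerA.
have -> : 2 / s * (s / 2) = 1 by field; rewrite s0.
by rewrite scale1r /u opprB addrC subrK.
Qed.

Theorem symmx_spectral (n : nat) (A : 'M[R]_n) :
  A^T = A -> exists Q lam, spectral_decomposition A Q lam.
Proof.
elim: n A => [|n IH] A symA.
  by exists 1%:M, 0; split; apply/matrixP => -[].
have [a /eigenvalueP [w wA w0]] := symmx_eigenvalue symA.
pose c := Num.sqrt ((w *m w^T) 0 0).
have c2 : c ^+ 2 = (w *m w^T) 0 0 by rewrite sqr_sqrtr // ltW // dotr_gt0.
have c0 : c != 0 by rewrite lt0r_neq0 // sqrtr_gt0 dotr_gt0.
pose v := c^-1 *: w.
have vA : v *m A = a *: v by rewrite -scalemxAl wA !scalerA mulrC.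
have vv : v *m v^T = 1%:M.
  rewrite /v linearZ /= -scalemxAl -scalemxAr scalerA [w *m _]mx11_scalar -c2.
  by rewrite scale_scalar_mx; congr (_%:M); field.
pose e : 'rV[R]_(1 + n) := row_mx 1%:M 0.
have ee : e *m e^T = 1%:M by rewrite tr_row_mx mul_row_col trmx1 mulmx1 mul0mx addr0.
have [H [Hs HH vH]] := reflection_exists vv ee.
have eH : e *m H = v by rewrite -vH -mulmxA HH mulmx1.
pose A1 : 'M[R]_(1 + n) := H *m A *m H.
have A1s : A1^T = A1 by rewrite /A1 !trmx_mul Hs symA mulmxA.
have eA1 : e *m A1 = a *: e.
  by rewrite /A1 !mulmxA eH vA -scalemxAl vH.
have A1E : A1 = block_mx a%:M 0 0 (drsubmx A1).
  move: eA1; rewrite -{1}[A1]submxK mul_row_block !mul1mx !mul0mx !addr0.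
  rewrite scale_row_mx scaler0 scalemx1 => /eq_row_mx [ul ur].
  rewrite -{1}[A1]submxK ul ur; congr block_mx.
  by rewrite -[LHS]trmxK trmx_dlsub A1s ur trmx0.
have [|Q2 [lam2 [QQ2 A2E]]] := IH (drsubmx A1).
  by rewrite trmx_drsub A1s.
pose Q3 : 'M[R]_(1 + n) := block_mx 1%:M 0 0 Q2.
pose lam : 'rV[R]_(1 + n) := row_mx a%:M lam2.
have QQ3 : Q3 *m Q3^T = 1%:M.
  rewrite /Q3 tr_block_mx !trmx0 trmx1 mulmx_block !mulmx0 !mul0mx !addr0 add0r.
  by rewrite mulmx1 QQ2 -scalar_mx_block.
have A1D : A1 = Q3 *m diag_mx lam *m Q3^T.
  rewrite [LHS]A1E [drsubmx A1 in LHS]A2E /Q3 /lam diag_mx_row tr_block_mx !trmx0 trmx1.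
  rewrite !mulmx_block !mulmx0 !mul0mx !addr0 !add0r mul1mx mulmx1 mul0mx.
  by rewrite mul0mx; congr block_mx; apply/matrixP => i j; rewrite !mxE !ord1.
have AE : A = H *m A1 *m H.
  by rewrite /A1 !mulmxA HH mul1mx -mulmxA HH mulmx1.
exists (H *m Q3), lam; split.
  by rewrite trmx_mul Hs mulmxA -[H *m Q3 *m _]mulmxA QQ3 mulmx1.
by rewrite trmx_mul Hs [LHS]AE A1D !mulmxA.
Qed.

Lemma matfun_unique (n : nat) (f : R -> R) (A Q1 Q2 : 'M[R]_n) lam1 lam2 :
  spectral_decomposition A Q1 lam1 -> spectral_decomposition A Q2 lam2 ->
  Q1 *m diag_mx (map_mx f lam1) *m Q1^T = Q2 *m diag_mx (map_mx f lam2) *m Q2^T.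
Proof.
move=> [u1 E1] [u2 E2].
have u1' := mulmx1C u1; have u2' := mulmx1C u2.
pose U := Q2^T *m Q1.
have UD : U *m diag_mx lam1 = diag_mx lam2 *m U.
  rewrite /U; transitivity (Q2^T *m A *m Q1).
    by rewrite E1 -!mulmxA u1' mulmx1.
  by rewrite E2 !mulmxA u2' mul1mx.
have UF : U *m diag_mx (map_mx f lam1) = diag_mx (map_mx f lam2) *m U.
  apply/matrixP => i j; move/matrixP/(_ i j): UD.
  rewrite !mul_mx_diag !mul_diag_mx !mxE; set x := \sum_k _.
  have [->|x0] := eqVneq x 0; first by rewrite !mulr0 !mul0r.
  by rewrite mulrC => /(mulIf x0) ->; rewrite mulrC.
have Q1E : Q1 = Q2 *m U by rewrite /U mulmxA u2 mul1mx.
have UU : U *m U^T = 1%:M.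
  by rewrite /U trmx_mul trmxK mulmxA -[Q2^T *m Q1 *m _]mulmxA u1 mulmx1.
clearbody U; rewrite Q1E trmx_mul -[Q2 *m U *m _]mulmxA UF !mulmxA.
by rewrite -[Q2 *m _ *m U *m U^T]mulmxA UU mulmx1.
Qed.

Lemma matfunE (n : nat) (f : R -> R) (A Q : 'M[R]_n) lam :
  spectral_decomposition A Q lam ->
  matfun f A = Q *m diag_mx (map_mx f lam) *m Q^T.
Proof.
move=> AQ; rewrite /matfun; case: xgetP => [_ _ [Q' [lam' [AQ' ->]]]|].
  exact: matfun_unique AQ' AQ.
by move=> /(_ (Q *m diag_mx (map_mx f lam) *m Q^T)) []; exists Q, lam.
Qed.

End SpectralTheorem.

(* Main.v *)
(* Let mu_m be the eigenvalues of B, with orthonormal eigenvectors given by the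
   columns of Q, and put h(s) = \sum_m Q_im Q_jm f(theta - s mu_m), so that
   h(1) = [f(A)]_ij.  Then h^(k)(0) = (-1)^k f^(k)(theta) [B^k]_ij, which is
   nonnegative for every k: if k < d then [B^k]_ij = 0 because d(i, j) >= d, and
   otherwise both factors are nonnegative.  Since |mu_m| <= ||B||_2, h is real
   analytic on [0, 1[, and nonnegativity of all derivatives propagates from 0 to
   the whole interval; the value at 1 is reached by continuity.  Working with h
   rather than with the Taylor series of f at theta avoids any discussion of the
   radius of convergence of the latter. *)
Require Import Defs.
From mathcomp Require Import all_boot all_order all_algebra.
From mathcomp Require Import all_classical all_reals all_analysis.
From mathcomp Require Import ring lra.
Import Order.TTheory GRing.Theory Num.Theory.
Import numFieldNormedType.Exports.
Local Open Scope classical_set_scope.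
Local Open Scope ring_scope.

Set Implicit Arguments.
Unset Strict Implicit.
Unset Printing Implicit Defensive.

(** * Real power series: termwise differentiation, Taylor coefficients, propagation of signs *)

Lemma is_cvg_series_shiftS (R : realType) (u : R^nat) :
  cvgn (series u) -> cvgn (series (fun n => u n.+1)).
Proof.
move=> cu; rewrite (_ : series _ = fun n => series u n.+1 - u 0%N); last first.
  by apply/funext => n; rewrite /series/= big_nat_recl//= addrC addKr.
apply: is_cvgB; last exact: is_cvg_cst.
by apply/cvg_ex; exists (limn (series u)); rewrite (cvg_shiftS (series u)).
Qed.

Section PowerSeries.
Context {R : realType}.
Implicit Types (f g : R -> R) (c : R^nat) (x y z r : R).

(** The quotient of the right side by [r - z] is a sum of [n.+1] products, each at least [z ^+ n].
    This bounds the factor [n.+1] created by differentiation. *)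
Lemma ler_subXX_ge n z r : 0 <= z -> z <= r ->
  (r - z) * (n.+1%:R * z ^+ n) <= r ^+ n.+1 - z ^+ n.+1.
Proof.
move=> z0 zr; rewrite subrXX ler_wpM2l ?subr_ge0//=.
rewrite -[n.+1 in leLHS]card_ord -sumr_const mulr_suml.
apply: ler_sum => i _; rewrite mul1r.
have /subnK {1}<- : (i <= n)%N by rewrite -ltnS.
rewrite exprD.
by rewrite ler_wpM2r ?exprn_ge0// lerXn2r// nnegrE (le_trans z0).
Qed.

Lemma is_cvg_pseries_diffs_inside c x z : cvgn (pseries c x) -> `|z| < `|x| ->
  cvgn (pseries (pseries_diffs c) z).
Proof.
move=> cx zx; pose r := (`|z| + `|x|) / 2.
have [zr rx] : `|z| < r /\ r < `|x| by rewrite /r; lra.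
have r0 : 0 <= r by rewrite (le_trans (normr_ge0 z))// ltW.
have cr : cvgn (pseries (fun i => `|c i|) r).
  by apply: is_cvg_pseries_inside_norm cx _; rewrite ger0_norm.
(* (n + 1) |z|^n <= r^(n+1) / (r - |z|) *)
apply: normed_cvg; apply: (@series_le_cvg _ _
    (fun n => (r - `|z|)^-1 * (`|c n.+1| * r ^+ n.+1))) => [n|n|n|].
- exact: normr_ge0.
- by rewrite !mulr_ge0 ?exprn_ge0// invr_ge0 subr_ge0 ltW.
- rewrite /pseries_diffs /= !normrM normr_nat normrX ler_pdivlMl ?subr_gt0//.
  have := ler_subXX_ge n (normr_ge0 _) (ltW zr).
  have := exprn_ge0 n.+1 (normr_ge0 z); have := normr_ge0 (c n.+1).
  move: (`|c _|) => C C0 zn0 le_rz.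
  rewrite [leLHS](_ : _ = C * ((r - `|z|) * (n.+1%:R * `|z| ^+ n))); last by ring.
  by rewrite ler_wpM2l// (le_trans le_rz)// gerBl.
- by apply: is_cvg_seriesZ; exact: (is_cvg_series_shiftS cr).
Qed.

Lemma derivable_pseries f c x r :
  (forall y, `|y - x| < r -> pseries c (y - x) @ \oo --> f y) ->
  forall y, `|y - x| < r ->
    derivable f y 1 /\ pseries (pseries_diffs c) (y - x) @ \oo --> f^`()%classic y.
Proof.
move=> fc y yr; set a := `|y - x| in yr *.
have a0 : 0 <= a by exact: normr_ge0.
(* Quarter points with [a < K2 < K1 < K0 < r]: [pseries_snd_diffs] needs two formal derivatives to
   converge at [K2], and each differentiation costs some radius. *)
pose K0 := (a + 3 * r) / 4; pose K1 := (a + r) / 2; pose K2 := (3 * a + r) / 4.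
have K0r : `|K0| < r by rewrite ger0_norm /K0; lra.
have K10 : `|K1| < `|K0| by rewrite !ger0_norm /K0 /K1; lra.
have K21 : `|K2| < `|K1| by rewrite !ger0_norm /K1 /K2; lra.
have aK2 : `|y - x| < `|K2| by rewrite -/a ger0_norm /K2; lra.
have cK0 : cvgn (pseries c K0).
  apply/cvg_ex; exists (f (K0 + x)); rewrite -{1}[K0](addrK x); apply: fc.
  by rewrite addrK.
have cK1 := is_cvg_pseries_diffs_inside cK0 K10.
have cK2 := is_cvg_pseries_inside cK0 (lt_trans K21 K10).
have dcK2 := is_cvg_pseries_inside cK1 K21.
have ddcK2 := is_cvg_pseries_diffs_inside cK1 K21.
have D := pseries_snd_diffs cK2 dcK2 ddcK2 aK2.
have Df : is_derive y 1 f (limn (pseries (pseries_diffs c) (y - x))).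
  have := @is_derive1_comp _ _ (shift (- x)) _ _ _ D (is_derive_shift y 1 (- x)).
  rewrite mulr1; apply: near_eq_is_derive.
  near=> z; apply: cvg_lim => //; apply: fc.
  near: z; apply/nbhs_ballP; exists (r - a) => /=; first by rewrite subr_gt0.
  move=> z; rewrite /ball/= distrC => zy.
  rewrite -(subrKA y) (le_lt_trans (ler_normD _ _))// -/a; lra.
split; first by case: Df.
rewrite derive1E (@derive_val _ _ _ _ _ _ _ Df).
by apply: is_cvg_pseries_inside dcK2 aK2.
Unshelve. all: end_near. Qed.

(** [derivable_pseries] returns its expansion on the same interval, so it can be iterated without
    shrinking [r]. *)
Lemma derivable_derive1n_pseries f c x r k :
  (forall y, `|y - x| < r -> pseries c (y - x) @ \oo --> f y) ->
  forall y, `|y - x| < r -> derivable (f^`(k)%classic) y 1 /\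
    pseries (iter k (@pseries_diffs R) c) (y - x) @ \oo --> f^`(k)%classic y.
Proof.
move=> fc.
have kc : forall y, `|y - x| < r ->
    pseries (iter k (@pseries_diffs R) c) (y - x) @ \oo --> f^`(k)%classic y.
  elim: k => [|k IH] y yr; first by rewrite derive1n0; exact: fc.
  by rewrite derive1nS iterS; have [] := derivable_pseries IH yr.
move=> y yr; split; last exact: kc.
by have [dfk _] := derivable_pseries kc yr; exact: dfk.
Qed.

(** The case [i = 0] turns the constant term of the [k]-th derivative into [k]! times the [k]-th
    coefficient. *)
Lemma iter_pseries_diffsE c k i :
  i`!%:R * iter k (@pseries_diffs R) c i = (i + k)`!%:R * c (i + k)%N.
Proof.
elim: k i => [|k IH] i; first by rewrite addn0.
by rewrite iterS /pseries_diffs mulrA -natrM mulnC -factS IH addSnnS.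
Qed.

Lemma iter_pseries_diffs_ge0 c k i :
  (forall j, 0 <= c j) -> 0 <= iter k (@pseries_diffs R) c i.
Proof.
move=> c0; elim: k i => // k IH i.
by rewrite iterS /pseries_diffs mulr_ge0.
Qed.

Lemma pseries_at0 c l : pseries c 0 @ \oo --> l -> l = c 0%N.
Proof.
(* The partial sums are constant only from index 1 on, the one at index 0 being empty. *)
move=> cl; have : [sequence pseries c 0 n.+1]_n @ \oo --> l by rewrite cvg_shiftS.
rewrite (_ : [sequence _]_n = cst (c 0%N)).
  by move=> /cvg_lim <-//; rewrite lim_cst.
apply/funext => n; rewrite /pseries/= /series/= big_nat_recl//= expr0 mulr1.
by rewrite big1 ?addr0// => i _; rewrite exprS mul0r mulr0.
Qed.

(** [analytic_at] with visible coefficients: iterated derivatives of sums and affine substitutions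
    are then read off the coefficients, with no chain rule of higher order. *)
Definition taylor_at f x c := exists2 r, 0 < r &
  forall y, `|y - x| < r -> pseries c (y - x) @ \oo --> f y.

Lemma analytic_at_taylor f x : analytic_at f x -> exists c, taylor_at f x c.
Proof. by move=> [c [r [r0 fc]]]; exists c, r. Qed.

Lemma taylor_at_analytic f x c : taylor_at f x c -> analytic_at f x.
Proof. by move=> [r r0 fc]; exists c, r. Qed.

Lemma taylor_at_derive1n f x c k :
  taylor_at f x c -> f^`(k)%classic x = k`!%:R * c k.
Proof.
move=> [r r0 fc]; have xr : `|x - x| < r by rewrite subrr normr0.
have [_] := derivable_derive1n_pseries k fc xr; rewrite subrr => /pseries_at0 ->.
by have := iter_pseries_diffsE c k 0; rewrite mul1r.
Qed.

Lemma analytic_at_continuous_derive1n f x k :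
  analytic_at f x -> {for x, continuous (f^`(k)%classic)}.
Proof.
move=> [c [r [r0 fc]]]; apply: differentiable_continuous.
apply/derivable1_diffP.
by have [|] := derivable_derive1n_pseries k fc (_ : `|x - x| < r);
  rewrite ?subrr ?normr0.
Qed.

Lemma taylor_at0 x : taylor_at (fun=> 0) x (fun=> 0).
Proof.
exists 1 => // y _; rewrite (_ : pseries _ _ = cst 0); first exact: cvg_cst.
by apply/funext => n; rewrite /pseries/= /series/= big1// => i _; rewrite mul0r.
Qed.

Lemma taylor_atD f g x c e : taylor_at f x c -> taylor_at g x e ->
  taylor_at (fun y => f y + g y) x (fun k => c k + e k).
Proof.
move=> [r r0 fc] [s s0 ge]; exists (Num.min r s); first by rewrite lt_min r0.
move=> y; rewrite lt_min => /andP[yr ys].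
rewrite (_ : pseries _ _ = pseries c (y - x) \+ pseries e (y - x)).
  by apply: cvgD; [exact: fc|exact: ge].
apply/funext => n; rewrite /pseries/= /series/= -big_split/=.
by apply: eq_bigr => i _; rewrite mulrDl.
Qed.

Lemma taylor_atZ f x c a : taylor_at f x c ->
  taylor_at (fun y => a * f y) x (fun k => a * c k).
Proof.
move=> [r r0 fc]; exists r => // y yr.
rewrite (_ : pseries _ _ = fun n => a * pseries c (y - x) n).
  by apply: cvgMl_tmp; exact: fc.
apply/funext => n; rewrite /pseries/= /series/= mulr_sumr.
by apply: eq_bigr => i _; rewrite mulrA.
Qed.

Lemma taylor_at_sum (I : Type) (s : seq I) (F : I -> R -> R) x (c : I -> R^nat) :
  (forall i, taylor_at (F i) x (c i)) ->
  taylor_at (fun y => \sum_(i <- s) F i y) x (fun k => \sum_(i <- s) c i k).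
Proof.
move=> Fc; elim: s => [|i s IH].
  under eq_fun do rewrite big_nil; under [X in taylor_at _ _ X]eq_fun do rewrite big_nil.
  exact: taylor_at0.
under eq_fun do rewrite big_cons; under [X in taylor_at _ _ X]eq_fun do rewrite big_cons.
exact: taylor_atD.
Qed.

Lemma taylor_at_affine f x c a b : taylor_at f (a * x + b) c ->
  taylor_at (fun y => f (a * y + b)) x (fun k => a ^+ k * c k).
Proof.
(* The added 1 keeps the radius positive when [a = 0]. *)
move=> [r r0 fc]; exists (r / (`|a| + 1)) => [|y yr].
  by rewrite divr_gt0// ltr_wpDl.
have E : a * y + b - (a * x + b) = a * (y - x) by ring.
rewrite (_ : pseries _ _ = pseries c (a * y + b - (a * x + b))).
  apply: fc; rewrite E normrM; move: yr; rewrite ltr_pdivlMr ?ltr_wpDl//.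
  by apply: le_lt_trans; rewrite mulrC ler_wpM2l// lerDl.
apply/funext => n; rewrite /pseries/= /series/= E.
by apply: eq_bigr => i _; rewrite exprMn; ring.
Qed.

Lemma analytic_derive1n_ge0 f a b : analytic_on `[a, b[ f ->
  (forall k, 0 <= f^`(k)%classic a) ->
  forall k x, a <= x < b -> 0 <= f^`(k)%classic x.
Proof.
move=> fan fa k x /andP[ax xb]; rewrite leNgt; apply/negP => fx.
(* All orders share one set: the sign of a single derivative to the right of a point depends on all
   the Taylor coefficients there. *)
pose T := [set t | a <= t < b /\ exists k, f^`(k)%classic t < 0].
have Tx : T x by split; [rewrite ax|exists k].
have Tinf : has_inf T by split; [exists x|exists a => t [/andP[]]].
have x0x : inf T <= x by apply: ge_inf => //; case: Tinf.
have ax0 : a <= inf T by apply: lb_le_inf; [exists x|move=> t [/andP[]]].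
set x0 := inf T in x0x ax0.
have lt_x0 t j : a <= t < x0 -> 0 <= f^`(j)%classic t.
  move=> /andP[at_ tx0]; rewrite leNgt; apply/negP => ft.
  have : x0 <= t.
    apply: ge_inf; first by case: Tinf.
    by split; [rewrite at_ (lt_trans tx0)// (le_lt_trans x0x)|exists j].
  by rewrite leNgt tx0.
have fan0 : analytic_at f x0 by apply: fan; rewrite /= in_itv/= ax0 (le_lt_trans x0x).
(* All derivatives are nonnegative at x0 by continuity from the left; hence so
   are the Taylor coefficients at x0, and therefore all derivatives slightly to
   the right of x0, against the choice of x0 as an infimum. *)
have fx0 j : 0 <= f^`(j)%classic x0.
  move: ax0; rewrite le_eqVlt => /predU1P[<-//|ax0].
  rewrite leNgt; apply/negP => fx0.
  have := analytic_at_continuous_derive1n (k := j) fan0.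
  move=> /cvgr_lt /(_ _ fx0) /nbhs_ballP[e /= e0 xe].
  (* A point left of [x0], within [e] of it, that does not leave the interval. *)
  pose t := Num.max a (x0 - e / 2).
  have tx0 : t < x0 by rewrite gt_max ax0/=; lra.
  have := @lt_x0 t j; rewrite le_max lexx tx0 => /(_ isT); rewrite leNgt => /negP; apply.
  apply: xe; rewrite /ball/= ger0_norm ?subr_ge0 1?ltW//.
  have : x0 - e / 2 <= t by rewrite le_max lexx orbT.
  lra.
have [c [r r0 fc]] := analytic_at_taylor fan0.
have c0 j : 0 <= c j.
  have := fx0 j; rewrite (taylor_at_derive1n _ (ex_intro2 _ _ r r0 fc)).
  by rewrite pmulr_rge0// ltr0n fact_gt0.
have [t [/andP[at_ tb] [j fjt]] tx0r] : exists2 t, T t & t < x0 + r.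
  by have [t Tt tr] := inf_adherent r0 Tinf; exists t.
have x0t : x0 <= t.
  by apply: ge_inf; [case: Tinf|split; [rewrite at_|exists j]].
have tr : `|t - x0| < r by rewrite ger0_norm ?subr_ge0//; lra.
have [_ cvj] := derivable_derive1n_pseries j fc tr.
move: fjt; rewrite ltNge => /negP; apply.
rewrite -(cvg_lim _ cvj)//; apply: limr_ge; first by apply: cvgP cvj.
near=> n; apply: sumr_ge0 => i _.
by rewrite mulr_ge0 ?iter_pseries_diffs_ge0// exprn_ge0// subr_ge0.
Unshelve. all: end_near.
Qed.

End PowerSeries.

(** * Eigenvalue bounds and functions of a matrix in an eigenbasis *)

Section SpectralNorm.
Context {R : realType} {n : nat}.
Implicit Types (A B Q : 'M[R]_n) (x : 'cV[R]_n) (lam : 'rV[R]_n).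

Lemma l2normZ a x : l2norm (a *: x) = `|a| * l2norm x.
Proof.
rewrite /l2norm -sqrtr_sqr -sqrtrM ?sqr_ge0// mulr_sumr.
by congr Num.sqrt; apply: eq_bigr => i _; rewrite mxE exprMn.
Qed.

Lemma normr_le_l2norm x i : `|x i 0| <= l2norm x.
Proof.
rewrite /l2norm -sqrtr_sqr ler_wsqrtr// (bigD1 i)//= lerDl.
by apply: sumr_ge0 => j _; exact: sqr_ge0.
Qed.

Lemma l2norm_le_spectral_norm B x : l2norm x <= 1 ->
  l2norm (B *m x) <= spectral_norm B.
Proof.
move=> x1; apply: ub_le_sup; last by exists x.
(* The supremum is an upper bound only for a bounded set. Entries of a vector in the unit ball are
   at most 1 in absolute value, so absolute row sums bound those of the image. *)
exists (Num.sqrt (\sum_i (\sum_j `|B i j|) ^+ 2)) => _ [y /= y1 <-].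
rewrite ler_wsqrtr//; apply: ler_sum => i _; rewrite mxE.
rewrite -[leLHS]real_normK ?num_real// lerXn2r ?nnegrE ?sumr_ge0//.
rewrite (le_trans (ler_norm_sum _ _ _))//; apply: ler_sum => j _.
by rewrite normrM ler_piMr// (le_trans (normr_le_l2norm y j)).
Qed.

(** Column [m] of [Q] is a unit vector that [B] multiplies by [lam 0 m]. *)
Lemma normr_eigenvalue_le_spectral_norm B Q lam m :
  spectral_decomposition B Q lam -> `|lam 0 m| <= spectral_norm B.
Proof.
move=> [QQ BE]; have QQ' := mulmx1C QQ.
have Q1 : l2norm (col m Q) = 1.
  rewrite -[RHS]sqrtr1; congr Num.sqrt.
  have /matrixP/(_ m m) := QQ'; rewrite !mxE eqxx mulr1n => <-.
  by apply: eq_bigr => i _; rewrite !mxE expr2.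
have Bcol : B *m col m Q = lam 0 m *: col m Q.
  rewrite {1}BE [in LHS]colE mulmxA -[_ *m Q^T *m Q]mulmxA QQ' mulmx1 -colE mul_mx_diag.
  by apply/matrixP => i j; rewrite !mxE mulrC.
have := @l2norm_le_spectral_norm B (col m Q).
by rewrite Bcol l2normZ Q1 mulr1; apply.
Qed.

Lemma spectral_entryE A Q lam i j : A = Q *m diag_mx lam *m Q^T ->
  A i j = \sum_m Q i m * Q j m * lam 0 m.
Proof.
move=> ->; rewrite mul_mx_diag mxE.
by apply: eq_bigr => m _; rewrite !mxE mulrAC.
Qed.

(** Keeping the same [Q] lets f(A) and the powers of B be expanded with the same weights. *)
Lemma spectral_decomposition_opp_shift A Q lam t : spectral_decomposition A Q lam ->
  spectral_decomposition (t%:M - A) Q (\row_m (t - lam 0 m)).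
Proof.
move=> [QQ AE]; split=> //.
rewrite (_ : \row_m _ = const_mx t - lam); last by apply/rowP => m; rewrite !mxE.
by rewrite raddfB/= mulmxBr mulmxBl -AE diag_const_mx mul_mx_scalar -scalemxAl QQ
  scalemx1.
Qed.

Lemma spectral_decompositionX A Q lam k : spectral_decomposition A Q lam ->
  A ^+ k = Q *m diag_mx (map_mx (fun a => a ^+ k) lam) *m Q^T.
Proof.
move=> [QQ AE]; have QQ' := mulmx1C QQ; elim: k => [|k IH].
  rewrite (_ : map_mx _ _ = const_mx 1); last by apply/rowP => m; rewrite !mxE.
  by rewrite diag_const_mx mulmx1 QQ.
rewrite (exprS _ _ : _ = A *m A ^+ k) IH {1}AE !mulmxA -[_ *m Q^T *m Q]mulmxA QQ' mulmx1.
rewrite -[Q *m _ *m diag_mx _]mulmxA mulmx_diag; congr (_ *m diag_mx _ *m _).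
by apply/rowP => m; rewrite !mxE exprS.
Qed.

End SpectralNorm.

(** * Graph distance and vanishing entries of matrix powers *)

Section Distance.
Context {R : realType} {n : nat}.
Implicit Types (A B : 'M[R]_n) (i j : 'I_n).

Lemma gdist_le_size A i p : path (edge A) i p ->
  (gdist A i (last i p) <= (size p)%:R%:E)%E.
Proof. by move=> ip; apply: ereal_inf_lbound; exists p. Qed.

(* Steps along nonzero diagonal entries are not edges, so the walk may be
   shorter than the exponent. *)
Lemma expmx_neq0_walk B k i j : (B ^+ k) i j != 0 ->
  exists p, [/\ path (edge B) i p, last i p = j & (size p <= k)%N].
Proof.
elim: k i => [|k IH] i.
  by rewrite expr0 mxE; have [->|_ /eqP//] := eqVneq i j; exists [::].
rewrite exprS mxE => /eqP ne0.
have [l] : exists l, B i l * (B ^+ k) l j != 0.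
  by apply/not_existsP => z; apply: ne0; apply: big1 => l _; apply/eqP/negP => /negP/z.
rewrite mulf_eq0 negb_or => /andP[Bil /IH[p [lp pj pk]]].
have [il|il] := eqVneq i l.
  by exists p; rewrite il; split=> //; exact: leqW.
by exists (l :: p); split; rewrite //= /edge il Bil.
Qed.

(** Off the diagonal the entries only change sign, so A and B have the same graph. *)
Lemma edge_scalar_sub A t : edge (t%:M - A) =2 edge A.
Proof.
move=> i j; rewrite /edge; have [//|ij] /= := eqVneq i j.
by rewrite !mxE (negbTE ij) mulr0n sub0r oppr_eq0.
Qed.

(** A nonzero entry would give a walk with at most [k] edges, hence fewer than [d]. *)
Lemma expmx_scalar_sub_eq0 A t k d i j : (d%:R%:E <= gdist A i j)%E -> (k < d)%N ->
  ((t%:M - A) ^+ k) i j = 0.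
Proof.
move=> dij kd; apply/eqP/negP => /negP/expmx_neq0_walk[p []].
rewrite (eq_path (edge_scalar_sub A t)) => /gdist_le_size + pj pk.
rewrite pj => /(le_trans dij); rewrite lee_fin ler_nat => /leq_ltn_trans.
by move=> /(_ _ (leq_ltn_trans pk kd)); rewrite ltnn.
Qed.

End Distance.

(** Continuity within [D] controls [f] only along points of [D], so [g] must eventually stay there.
    This serves at an endpoint of the closed interval. *)
Lemma within_continuous_cvg_comp (R : realType) (T : Type) (F : set_system T)
    (FF : Filter F) (D : set R) (f : R -> R) (g : T -> R) (y : R) :
  {within D, continuous f} -> D y -> g @ F --> y -> (\forall t \near F, D (g t)) ->
  f \o g @ F --> f y.
Proof.
move=> /subspace_continuousP fD Dy gy gD; have /(_ y Dy) fy := fD.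
apply: cvg_comp fy => P DP; have := gy _ DP.
by apply: filterS2 gD => t Dgt; apply.
Qed.

Lemma expmx_ge0 (R : realType) (n : nat) (B : 'M[R]_n) k i j :
  (forall i j, 0 <= B i j) -> 0 <= (B ^+ k) i j.
Proof.
move=> B0; elim: k i j => [|k IH] i j; first by rewrite expr0 mxE.
by rewrite exprS mxE sumr_ge0// => l _; rewrite mulr_ge0.
Qed.

(** * Signs of the entries of f(theta I - s B) as s runs from 0 to 1 *)

Unset Implicit Arguments.

Theorem proposition3p13 (R : realType) (n : nat) (theta : R) (A B : 'M[R]_n)
  (f : R -> R) (eps : R) (d : nat)
  (A_def : A = theta%:M - B)
  (A_sym : A^T = A)
  (B_ge0 : forall i j, 0 <= B i j)
  (B_le_theta : spectral_norm B <= theta)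
  (f_continuous :
    {within `[theta - spectral_norm B, theta + spectral_norm B],
      continuous f})
  (eps_gt0 : 0 < eps)
  (f_analytic :
    analytic_on `]theta - spectral_norm B, theta + spectral_norm B + eps[ f)
  (d_gt0 : (0 < d)%N)
  (f_sign : forall k : nat, (d <= k)%N -> 0 <= (-1) ^+ k * f^`(k)%classic theta) :
  forall i j : 'I_n, (d%:R%:E <= gdist A i j)%E -> 0 <= matfun f A i j.
Proof.
move=> i j dij; have [Q [lam AQ]] := symmx_spectral A_sym.
have BA : B = theta%:M - A by rewrite A_def subKr.
have := spectral_decomposition_opp_shift theta AQ; rewrite -BA => BQ.
set mu := \row_m _ in BQ.
have lamE m : lam 0 m = theta - mu 0 m by rewrite mxE subKr.
pose w m := Q i m * Q j m.
have BXE k : (B ^+ k) i j = \sum_m w m * mu 0 m ^+ k.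
  rewrite (spectral_entryE _ _ (spectral_decompositionX k BQ)).
  by apply: eq_bigr => m _; rewrite mxE.
have BX0 k : (k < d)%N -> (B ^+ k) i j = 0.
  by rewrite BA; exact: expmx_scalar_sub_eq0.
rewrite (spectral_entryE _ _ (matfunE f AQ)).
under eq_bigr do rewrite mxE lamE.
have mu_le m := normr_eigenvalue_le_spectral_norm m BQ.
set rho := spectral_norm B in mu_le f_continuous f_analytic B_le_theta.
(* If ||B||_2 = 0 then f need not be analytic at theta, which is then the
   endpoint of the open interval. *)
have [rho0|rho0] := leP rho 0.
  (* All eigenvalues of [B] vanish, so f(A) is a multiple of the identity; since [0 < d], the entry
     of [B ^+ 0] is zero. *)
  suff -> : \sum_m w m * f (theta - mu 0 m) = f theta * (B ^+ 0) i j.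
    by rewrite BX0// mulr0.
  rewrite BXE mulr_sumr; apply: eq_bigr => m _.
  have /eqP : `|mu 0 m| = 0.
    by apply/le_anti; rewrite normr_ge0 (le_trans (mu_le m)).
  by rewrite normr_eq0 => /eqP ->; rewrite subr0 expr0 mulr1 mulrC.
pose h s := \sum_m w m * f (- mu 0 m * s + theta).
have h_an : analytic_on `[0, 1[ h.
  move=> s; rewrite /= in_itv/= => /andP[s0 s1].
  have /choice[c fc] m : exists c, taylor_at f (- mu 0 m * s + theta) c.
    apply: analytic_at_taylor; apply: f_analytic; rewrite /= in_itv/=.
    (* Strict because [s < 1] and [0 < rho]; the argument of [f] thus avoids the left endpoint,
       where only continuity is assumed. *)
    have : `|- mu 0 m * s| < rho.
      rewrite normrM normrN (ger0_norm s0).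
      by rewrite (le_lt_trans (ler_wpM2r s0 (mu_le m)))// gtr_pMr.
    rewrite ltr_norml; lra.
  apply: taylor_at_analytic (taylor_at_sum _ _) => m.
  by apply/taylor_atZ/taylor_at_affine/fc.
have h_derive k : 0 <= h^`(k)%classic 0.
  have [c fc] : exists c, taylor_at f theta c.
    by apply: analytic_at_taylor; apply: f_analytic; rewrite /= in_itv/=; lra.
  have hc : taylor_at h 0 (fun k => \sum_m w m * ((- mu 0 m) ^+ k * c k)).
    apply: taylor_at_sum => m; apply/taylor_atZ/taylor_at_affine.
    by rewrite mulr0 add0r.
  rewrite (taylor_at_derive1n k hc).
  (* The sign (-1)^k comes out of the powers of [- mu 0 m]; the weighted powers of [mu] then add up
     to the entry of [B ^+ k]. *)
  have -> : k`!%:R * \sum_m w m * ((- mu 0 m) ^+ k * c k) =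
      (-1) ^+ k * f^`(k)%classic theta * (B ^+ k) i j.
    rewrite (taylor_at_derive1n k fc) BXE !mulr_sumr; apply: eq_bigr => m _.
    by rewrite [(- mu 0 m) ^+ k]exprNn; ring.
  have [kd|dk] := ltnP k d; first by rewrite BX0// mulr0.
  by rewrite mulr_ge0 ?f_sign ?expmx_ge0.
have h_ge0 s : 0 <= s < 1 -> 0 <= h s.
  by move=> s01; have := analytic_derive1n_ge0 h_an h_derive 0 s01.
(* At [s = 1] an argument of [f] may equal [theta - rho], so the value is reached only as a left
   limit. *)
have h1 : h s @[s --> 1^'-] --> \sum_m w m * f (theta - mu 0 m).
  apply: cvg_big => [|m _]; [exact: add_continuous|apply: cvgMl_tmp].
  apply: (@within_continuous_cvg_comp _ _ _ _ _ f (fun s => - mu 0 m * s + theta)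
    _ f_continuous).
  - by rewrite /= in_itv/=; have := mu_le m; rewrite ler_norml; lra.
  - apply: cvg_at_left_filter.
    rewrite [X in _ --> X](_ : _ = - mu 0 m * 1 + theta); last by ring.
    by apply: cvgD; [apply: cvgMl_tmp; exact: cvg_id|exact: cvg_cst].
  - near=> s.
    have s0 : 0 <= s by near: s; exact: nbhs_left_ge.
    have s1 : s <= 1 by near: s; exact: nbhs_left_le.
    have : `|- mu 0 m * s| <= rho.
      by rewrite normrM normrN (ger0_norm s0) (le_trans _ (mu_le m))// ler_piMr.
    by rewrite /= in_itv/= ler_norml; lra.
rewrite -(cvg_lim _ h1)//; apply: limr_ge; first by apply: cvgP h1.
near=> s; apply: h_ge0; apply/andP; split; last by near: s; exact: nbhs_left_lt.
by near: s; exact: nbhs_left_ge.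
Unshelve. all: end_near. Qed.
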